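(* There is a universal constant $c>0$ such that the following holds. For any integer $T>c$ and integers $n,d$ with $d>cT$ and $n>cT^2\log(T)$, for every deterministic algorithm that interacts for $T$ rounds with the two-sided oracle and then outputs $\mathbf{w}_{T+1}\in\mathbb{R}^d$, there exists a matrix $A\in\mathbb{R}^{n\times d}$ satisfying \[ \max_{l\in[n]}\|A_l\|_2\le 1\qquad\text{and}\qquad \max_{\mathbf{w}:\|\mathbf{w}\|_2\le 1}\ \min_{\mathbf{p}\in\Delta^{n-1}}\mathbf{p}^\top A\mathbf{w}\ \ge\ \frac{1}{cT\sqrt{T\log(n)}}, \] yet the algorithm's output after $T$ rounds of interaction with $\mathcal{O}_2^A$ satisfies $\min_{\mathbf{p}\in\Delta^{n-1}}\mathbf{p}^\top A\mathbf{w}_{T+1}\le 0$.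
   Context: $\Delta^{n-1}=\{\mathbf{p}\in\mathbb{R}^n:\ p_i\ge0,\ \sum_ip_i=1\}$; $A_l$ is the $l$-th row of $A$; $\log$ is the natural logarithm. The two-sided oracle $\mathcal{O}_2^A$: given a query $(\mathbf{p},\mathbf{w})\in\mathbb{R}^n\times\mathbb{R}^d$ (arbitrary vectors, not restricted to the simplex or unit ball), it returns $A\mathbf{w}$ and $\mathbf{p}^\top A$. A deterministic algorithm interacting with the oracle for $T$ rounds chooses, at each round $t=1,\dots,T$, a query $(\mathbf{p}_t,\mathbf{w}_t)$ as a deterministic function of the responses from rounds $1,\dots,t-1$, and after round $T$ outputs $\mathbf{w}_{T+1}\in\mathbb{R}^d$ as a deterministic function of all responses. *)

(* Defs.v *)
From HB Require Import structures.
From mathcomp Require Import all_boot all_order all_algebra.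
From mathcomp Require Import all_classical all_reals.
From mathcomp Require Import exp.
From mathcomp Require Import Rstruct.
Set Implicit Arguments. Unset Strict Implicit. Unset Printing Implicit Defensive.
Import Order.TTheory GRing.Theory Num.Theory.
Local Open Scope ring_scope.

Notation R := Rdefinitions.R.

Definition vnorm2 (m : nat) (v : 'cV[R]_m) : R :=
  Num.sqrt (\sum_(j < m) (v j 0) ^+ 2).
Definition rownorm2 (n d : nat) (A : 'M[R]_(n, d)) (l : 'I_n) : R :=
  Num.sqrt (\sum_(j < d) (A l j) ^+ 2).

Definition in_simplex (n : nat) (p : 'cV[R]_n) : Prop :=
  (forall i, 0 <= p i 0) /\ \sum_(i < n) p i 0 = 1.

Definition bilin (n d : nat) (p : 'cV[R]_n) (A : 'M[R]_(n, d)) (w : 'cV[R]_d) : R :=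
  ((p^T *m A *m w) 0 0).

Definition query (n d : nat) := ('cV[R]_n * 'cV[R]_d)%type.
Definition response (n d : nat) := ('cV[R]_n * 'rV[R]_d)%type.

Definition oracle2 (n d : nat) (A : 'M[R]_(n, d)) (q : query n d) : response n d :=
  (A *m q.2, q.1^T *m A).

(* A deterministic algorithm: the query at round t is a function of the
   responses of rounds 1..t-1 (given as the list of past responses, whose
   length is t-1), and the final output is a function of all T responses. *)
Record algorithm (n d : nat) := Algorithm {
  alg_query : seq (response n d) -> query n d;
  alg_output : seq (response n d) -> 'cV[R]_d
}.

Fixpoint history (n d : nat) (alg : algorithm n d) (A : 'M[R]_(n, d)) (k : nat)
  : seq (response n d) :=
  match k with
  | 0 => [::]
  | k'.+1 => let h := history alg A k' in
             rcons h (oracle2 A (alg_query alg h))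
  end.

Definition run_output (n d : nat) (alg : algorithm n d) (A : 'M[R]_(n, d)) (T : nat)
  : 'cV[R]_d := alg_output alg (history alg A T).

(* Main.v *)
Require Import Defs.
From HB Require Import structures.
From mathcomp Require Import all_boot all_order all_algebra.
From mathcomp Require Import all_classical all_reals.
From mathcomp Require Import exp.
From mathcomp Require Import Rstruct.
From mathcomp Require Import ring lra zify.
Set Implicit Arguments. Unset Strict Implicit. Unset Printing Implicit Defensive.
Import Order.TTheory GRing.Theory Num.Theory.
Local Open Scope ring_scope.

(** An adaptive adversary builds orthonormal vectors [v_0, v_1, ...] and, for each
    row, convex weights on the differences [v_i - v_(i+1)], so that (up to a factor 2)
    [A] is the sum over [i < k = 2 T] of [x_i (v_i - v_(i+1))^T], with [v_k = 0].
    Every such row has margin 1/2 against [\sum_i (k - i) v_i], a vector of norm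
    [O(T sqrt T)].

    After [j] rounds only [x_0, ..., x_(j-1)] and [v_0, ..., v_j] are committed; the
    remaining weight [r = 1 - \sum_(i < j) x_i] is spread evenly over the indices
    [i >= j], so that the rest of the sum telescopes to [r v_j^T / (k - j)] and the
    answers reveal nothing of the later vectors.  Committing [x_j] changes [A] by a
    rank-one term, invisible to all previous queries if the new vector is
    orthogonal to the queried [w]'s and [x_j - r / (k - j)] is orthogonal to the
    queried [p]'s.  As [x_j] one takes a vertex of the polytope of [0 <= x <= r]
    subject to these linear constraints: it has at most as many entries strictly
    between [0] and [r] as there are constraints.  Hence after [T] rounds, among the
    [n] rows, of total remaining weight [n / 2], only [O(T^2)] have a fractional
    weight, and some row is still untouched: it is a multiple of [v_T], which is
    orthogonal to the output. *)

(** * Dot products and orthogonal vectors *)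

Definition dot (F : fieldType) (m : nat) (u v : 'cV[F]_m) : F :=
  \sum_i u i 0 * v i 0.

Section Dot.
Variables (F : fieldType) (m : nat).
Implicit Types (u v w : 'cV[F]_m).

Lemma dotC u v : dot u v = dot v u.
Proof. by apply: eq_bigr => i _; rewrite mulrC. Qed.

Lemma dotDr u v w : dot u (v + w) = dot u v + dot u w.
Proof. by rewrite -big_split; apply: eq_bigr => i _; rewrite mxE mulrDr. Qed.

Lemma dotZr a u v : dot u (a *: v) = a * dot u v.
Proof. by rewrite mulr_sumr; apply: eq_bigr => i _; rewrite mxE mulrCA. Qed.

Lemma dotDl u v w : dot (u + v) w = dot u w + dot v w.
Proof. by rewrite dotC dotDr !(dotC w). Qed.

Lemma dotZl a u v : dot (a *: u) v = a * dot u v.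
Proof. by rewrite dotC dotZr dotC. Qed.

Lemma dotBr u v w : dot u (v - w) = dot u v - dot u w.
Proof. by rewrite -scaleN1r dotDr dotZr mulN1r. Qed.

Lemma dotBl u v w : dot (u - v) w = dot u w - dot v w.
Proof. by rewrite dotC dotBr !(dotC w). Qed.

Lemma dot_delta (l : 'I_m) v : dot (delta_mx l 0) v = v l 0.
Proof.
rewrite /dot (bigD1 l) //= mxE !eqxx mul1r big1 ?addr0 // => i il.
by rewrite mxE (negPf il) mul0r.
Qed.

Lemma trmx_mul_dot u v : u^T *m v = (dot u v)%:M.
Proof.
apply/matrixP => i j; rewrite !ord1 !mxE mulr1n.
by apply: eq_bigr => l _; rewrite mxE.
Qed.

(** The matrix with columns [s] has more rows than columns, hence a nonzero left kernel. *)
Lemma exists_orthogonal (s : seq 'cV[F]_m) : (size s < m)%N ->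
  exists2 z, z != 0 & {in s, forall u, dot u z = 0}.
Proof.
move=> sm; pose M := \matrix_(i < m, j < size s) (s`_j) i 0.
have K0 : kermx M != 0.
  rewrite kermx_eq0 /row_free; apply/eqP => rM.
  by have := rank_leq_col M; rewrite rM leqNgt sm.
have: (nz_row (kermx M) <= kermx M)%MS by exact: nz_row_sub.
move/sub_kermxP => zM; exists (nz_row (kermx M))^T.
  by apply: contraNneq K0 => z0; rewrite -nz_row_eq0 -[nz_row _]trmxK z0 trmx0.
move=> u us; have im : (index u s < size s)%N by rewrite index_mem.
move/matrixP/(_ 0 (Ordinal im)): zM; rewrite !mxE => <-.
by apply: eq_bigr => i _; rewrite !mxE /= nth_index // mulrC.
Qed.
End Dot.

Lemma dot_ge0 (F : realFieldType) m (u : 'cV[F]_m) : 0 <= dot u u.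
Proof. by apply: sumr_ge0 => i _; rewrite -expr2 sqr_ge0. Qed.

Lemma dot_eq0 (F : realFieldType) m (u : 'cV[F]_m) : (dot u u == 0) = (u == 0).
Proof.
apply/eqP/eqP => [u0|->]; last by rewrite /dot big1 // => i _; rewrite mxE mul0r.
apply/matrixP => i j; rewrite ord1 mxE; apply/eqP; rewrite -sqrf_eq0 expr2.
move/eqP: u0; rewrite psumr_eq0; last by move=> l _; rewrite -expr2 sqr_ge0.
by move/allP/(_ i); rewrite mem_index_enum => /(_ isT).
Qed.

Lemma dot_unit_le1 (F : realFieldType) m (u v : 'cV[F]_m) :
  dot u u = 1 -> dot v v = 1 -> `|dot u v| <= 1.
Proof.
move=> u1 v1; have := dot_ge0 (u + v); have := dot_ge0 (u - v).
rewrite !(dotBl, dotBr, dotDl, dotDr) u1 v1 (dotC v u) ler_norml => *.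
apply/andP; split; lra.
Qed.

Lemma exists_unit_orthogonal (F : rcfType) m (s : seq 'cV[F]_m) : (size s < m)%N ->
  exists2 z, dot z z = 1 & {in s, forall u, dot u z = 0}.
Proof.
case/exists_orthogonal => z z0 zs.
have zz : 0 < dot z z by rewrite lt_def dot_eq0 z0 dot_ge0.
exists ((Num.sqrt (dot z z))^-1 *: z); last by move=> u /zs; rewrite dotZr => ->; rewrite mulr0.
rewrite dotZl dotZr mulrA -invfM -expr2 sqr_sqrtr ?ltW // mulVf //.
by rewrite gt_eqF.
Qed.

(** * Rounding to nearly integral points of a box under linear constraints *)

Definition fractional (F : realFieldType) n (r x : 'cV[F]_n) : {set 'I_n} :=
  [set l | (x l 0 != 0) && (x l 0 != r l 0)].

Section Rounding.
Variables (F : realFieldType) (n : nat) (r : 'cV[F]_n).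
Definition in_box (x : 'cV[F]_n) := forall l, 0 <= x l 0 <= r l 0.

(* Move along a direction z orthogonal to ps and supported on the fractional
   coordinates, until the first of them reaches an end of its interval. *)
Lemma fewer_fractional (ps : seq 'cV[F]_n) x : in_box x ->
  (size ps < #|fractional r x|)%N ->
  exists y, [/\ in_box y, {in ps, forall p, dot p y = dot p x} &
    (#|fractional r y| < #|fractional r x|)%N].
Proof.
move=> bx; set Fx := fractional r x => szF.
(* The unit vectors off [Fx] force [z] to be supported on [Fx]; there are still fewer than [n]
   constraints. *)
pose s := ps ++ [seq delta_mx l 0 | l <- enum (~: Fx)].
have: (size s < n)%N.
  rewrite size_cat size_map -cardE cardsCs finset.setCK card_ord.
  have : (#|Fx| <= n)%N by rewrite (leq_trans (max_card _)) ?card_ord.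
  by move: szF; move: #|Fx| => f; lia.
case/exists_orthogonal => z z0 zs.
have zF l : l \notin Fx -> z l 0 = 0.
  move=> lF; rewrite -(dot_delta l z); apply: zs.
  by rewrite mem_cat; apply/orP; right; apply: map_f; rewrite mem_enum inE.
have [l1 l1z] : exists l, z l 0 != 0.
  apply/existsP; apply: contraNT z0 => /existsPn z0.
  by apply/eqP/matrixP => i j; rewrite ord1 mxE; apply/eqP; rewrite -[_ == _]negbK z0.
(* The step length at which coordinate [l] reaches the end of its interval that [z] points to. *)
pose tau l := (if 0 < z l 0 then r l 0 - x l 0 else - x l 0) / z l 0.
case: (@arg_minP _ _ _ l1 (fun l => z l 0 != 0) tau l1z) => l0 l0z tmin.
have tau_ge0 l : 0 <= tau l.
  rewrite /tau; have /andP[x0 xr] := bx l; case: ltrP => zl.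
    by rewrite divr_ge0 ?subr_ge0 // ltW.
  by rewrite -mulrNN opprK -invrN mulr_ge0 // invr_ge0 oppr_ge0.
have mulz l : z l 0 != 0 -> tau l * z l 0 = if 0 < z l 0 then r l 0 - x l 0 else - x l 0.
  by move=> zl; rewrite mulfVK.
pose y := x + tau l0 *: z.
have yE l : y l 0 = x l 0 + tau l0 * z l 0 by rewrite !mxE.
have y_out l : l \notin Fx -> y l 0 = x l 0 by move=> /zF zl; rewrite yE zl mulr0 addr0.
exists y; split.
- move=> l; rewrite yE; have /andP[x0 xr] := bx l.
  have [zl|zl] := eqVneq (z l 0) 0; first by rewrite zl mulr0 addr0 x0.
  have := mulz _ zl; have := tmin _ zl; have := tau_ge0 l0.
  move: (tau l0) (tau l) => t t' t0 tt'; case: ifPn => [zp|]; last rewrite -leNgt => zn.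
    have := ler_wpM2r (ltW zp) tt'; have := mulr_ge0 t0 (ltW zp); lra.
  have := ler_wnM2r zn tt'; have := mulr_ge0_le0 t0 zn; lra.
- move=> p pp; rewrite dotDr dotZr zs ?mulr0 ?addr0 //.
  by rewrite mem_cat pp.
- apply: proper_card; apply/properP; split.
    apply/fintype.subsetP => l; apply: contraLR => lF.
    by move: (lF); rewrite !inE y_out.
  exists l0; first by apply: contraNT l0z => /zF ->.
  rewrite inE yE mulz //; case: ifP => _; last by rewrite subrr eqxx.
  by rewrite addrC subrK eqxx andbF.
Qed.

Lemma exists_rounding (ps : seq 'cV[F]_n) x : in_box x ->
  exists y, [/\ in_box y, {in ps, forall p, dot p y = dot p x} &
    (#|fractional r y| <= size ps)%N].
Proof.
have [m] := ubnP #|fractional r x|; elim: m => // m IHm in x * => xm bx.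
have [le|lt] := leqP #|fractional r x| (size ps); first by exists x.
have [y [bY py lty]] := fewer_fractional bx lt.
have [|//|z [bz pz lez]] := IHm y; first by lia.
by exists z; split => // p pp; rewrite pz ?py.
Qed.
End Rounding.

(** * The stages of the adversary *)

Lemma mul_outer (F : fieldType) m n (x : 'cV[F]_n) (v u : 'cV[F]_m) :
  x *m v^T *m u = dot v u *: x.
Proof. by rewrite -mulmxA trmx_mul_dot mul_mx_scalar. Qed.

(** It suffices to compare answers along the run on [A]: by induction both runs ask the same
    queries. *)
Lemma eq_history n d (alg : algorithm n d) (A B : 'M[R]_(n, d)) m :
  (forall s, (s < m)%N ->
     oracle2 B (alg_query alg (history alg A s)) =
     oracle2 A (alg_query alg (history alg A s))) ->
  history alg B m = history alg A m.
Proof.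
elim: m => //= m IHm AB; rewrite IHm ?AB // => s sm.
by apply: AB; apply: ltnW.
Qed.

Lemma size_history n d (alg : algorithm n d) (A : 'M[R]_(n, d)) m :
  size (history alg A m) = m.
Proof. by elim: m => //= m IHm; rewrite size_rcons IHm. Qed.

(* The adversary after [j] commitments: [2 A] is the sum of
   [x_i (v_i - v_(i+1))^T] for [i < j] and of [r v_j^T / (k - j)], where
   [vs = v_0, ..., v_j], [v = v_j], [r = 1 - \sum_i x_i] and
   [w = \sum_i (k - i) v_i]. *)
Record stage n d (alg : algorithm n d) (k j : nat) (vs : seq 'cV[R]_d)
    (v w : 'cV[R]_d) (A : 'M[R]_(n, d)) (r : 'cV[R]_n) : Prop := Stage {
  stage_size : size vs = j.+1;
  stage_mem : v \in vs;
  stage_unit : {in vs, forall u, dot u u = 1};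
  stage_query : forall s, (s <= j)%N ->
    dot v (alg_query alg (history alg A s)).2 = 0;
  stage_span : forall u, {in vs, forall v', dot v' u = 0} ->
    A *m u = 0 /\ dot w u = 0;
  stage_row : forall u, {in vs, forall v', `|dot v' u| <= 1} ->
    forall l, `|(A *m u) l 0 - r l 0 / (k - j)%:R * (dot v u / 2)| <= 1 - r l 0;
  stage_margin : A *m w = const_mx 2^-1;
  stage_dotw : dot v w = (k - j)%:R;
  stage_normw : dot w w <= j.+1%:R * k%:R ^+ 2;
  stage_box : in_box (const_mx 1) r;
  stage_sum : \sum_l r l 0 = n%:R * (k - j)%:R / k%:R;
  stage_fractional : (#|fractional (const_mx 1%R) r| <= j * k.+1)%N;
  stage_untouched : forall l, r l 0 = 1 ->
    forall u, (A *m u) l 0 = dot v u / 2 / (k - j)%:R }.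

Lemma stage0 n d (alg : algorithm n d) k : (0 < k)%N -> (1 < d)%N ->
  exists vs v w A r, stage alg k 0 vs v w A r.
Proof.
move=> k0 d1; have kp : 0 < k%:R :> R by rewrite ltr0n.
have kn : k%:R != 0 :> R by rewrite gt_eqF.
have [|v v1 vq] := @exists_unit_orthogonal R d [:: (alg_query alg [::]).2].
  by [].
pose A : 'M[R]_(n, d) := k%:R^-1 *: (const_mx 2^-1 *m v^T).
have Au u : A *m u = const_mx (k%:R^-1 * (dot v u / 2)).
  by rewrite -scalemxAl mul_outer; apply/matrixP => i l; rewrite !mxE.
exists [:: v], v, (k%:R *: v), A, (const_mx 1).
split; rewrite ?subn0 //.
- by rewrite inE.
- by move=> u; rewrite inE => /eqP ->.
- by case=> // _; rewrite /= dotC vq ?inE.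
- move=> u /(_ v); rewrite inE eqxx => /(_ isT) vu.
  by rewrite Au dotZl vu mul0r !mulr0; split => //; apply/matrixP => i l; rewrite !mxE.
- by move=> u _ l; rewrite Au !mxE mul1r subrr normr0 subrr.
- by rewrite Au dotZr v1 mulr1 mulKf.
- by rewrite dotZr v1 mulr1.
- by rewrite dotZl dotZr v1 mulr1 mul1r expr2.
- by move=> l; rewrite mxE ler01 lexx.
- under eq_bigr do rewrite mxE.
  by rewrite sumr_const card_ord mulfK.
- by rewrite mul0n leqn0 cards_eq0; apply/eqP/finset.setP => l; rewrite !inE !mxE eqxx andbF.
- by move=> l _ u; rewrite Au mxE mulrC.
Qed.

Lemma stageS n d (alg : algorithm n d) k j vs v w A r :
  (j.+1 < k)%N -> (2 * j + 3 < d)%N -> stage alg k j vs v w A r ->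
  exists vs' v' w' A' r', stage alg k j.+1 vs' v' w' A' r'.
Proof.
move=> jk jd [vs_size v_vs vs1 vq span row_le Aw vw ww r_box r_sum r_frac r1].
have [a ap kjE] : exists2 a : R, 0 < a & (k - j.+1)%:R = a /\ (k - j)%:R = a + 1.
  exists (k - j.+1)%:R; first by rewrite ltr0n subn_gt0.
  by split=> //; rewrite natr1; congr _%:R; lia.
have [kj1 kj] := kjE; rewrite kj in row_le vw r_sum r1.
have an : a != 0 by rewrite gt_eqF.
have a1n : a + 1 != 0 by rewrite gt_eqF // addr_gt0.
pose q s := alg_query alg (history alg A s).
(* The all-ones vector fixes the total of [x], which gives the remaining weight exactly. *)
pose ps := const_mx 1 :: [seq (q s).1 | s <- iota 0 j.+1].
(* Since [a + 1] is [k - j], the rounding starts from the even share of [r] over the indices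
   [i >= j]. *)
have /exists_rounding - /(_ ps) [x [x_box xp x_frac]] : in_box r ((a + 1)^-1 *: r).
  move=> l; rewrite mxE; have /andP[r0 _] := r_box l.
  rewrite mulr_ge0 ?invr_ge0 ?addr_ge0 // ?(ltW ap) //=.
  by rewrite ler_piMl // invf_le1 ?addr_gt0 // lerDr ltW.
pose e := x - (a + 1)^-1 *: r.
have pe s : (s <= j)%N -> dot (q s).1 e = 0.
  move=> sj; rewrite dotBr xp ?subrr // inE; apply/orP; right.
  by apply: (map_f (fun s => (q s).1)); rewrite mem_iota.
(* Query [j.+1] is included: it depends only on the answers to queries [0, ..., j], which the update
   leaves unchanged. *)
pose ws := [seq (q s).2 | s <- iota 0 j.+2].
have [|v' v'1 v'o] := @exists_unit_orthogonal R d (vs ++ ws).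
  by rewrite size_cat vs_size size_map size_iota; lia.
have v'vs : {in vs, forall u, dot u v' = 0}.
  by move=> u uvs; apply: v'o; rewrite mem_cat uvs.
have v'q s : (s <= j.+1)%N -> dot v' (q s).2 = 0.
  move=> sj; rewrite dotC; apply: v'o; rewrite mem_cat; apply/orP; right.
  by apply: (map_f (fun s => (q s).2)); rewrite mem_iota.
have [Av' wv'] := span _ v'vs.
(* Twice the update replaces [r v^T / (a + 1)] by [x (v - v')^T + (r - x) v'^T / a]; the difference
   factors through [e]. *)
pose A' := A + 2^-1 *: (e *m (v - ((a + 1) / a) *: v')^T).
have A'u u : A' *m u = A *m u + ((dot v u - (a + 1) / a * dot v' u) / 2) *: e.
  by rewrite mulmxDl -scalemxAl mul_outer dotBl dotZl scalerA mulrC.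
have hist m : (m <= j.+1)%N -> history alg A' m = history alg A m.
  move=> mj; apply: eq_history => s sm; have sj : (s <= j)%N by lia.
  rewrite /oracle2 -/(q s) A'u vq // v'q ?(leq_trans sj) // mulr0 subrr mul0r scale0r addr0.
  congr pair; rewrite mulmxDr -scalemxAr mulmxA trmx_mul_dot pe //.
  by rewrite raddf0 mul0mx scaler0 addr0.
have rle l : 0 <= r l 0 <= 1 by have := r_box l; rewrite mxE.
exists (v' :: vs), v', (w + a *: v'), A', (r - x); split; rewrite ?kj1.
- by rewrite /= vs_size.
- exact: mem_head.
- by move=> u; rewrite inE => /orP[/eqP ->//|/vs1].
- by move=> s sj; rewrite hist // v'q.
- move=> u uo; have uvs : {in vs, forall v0, dot v0 u = 0}.
    by move=> v0 v0vs; apply: uo; rewrite inE v0vs orbT.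
  have [Au0 wu0] := span _ uvs.
  rewrite A'u Au0 dotDl dotZl wu0 uvs // uo ?mem_head // !mulr0 subrr mul0r scale0r !addr0.
  by [].
- move=> u uo l; have uvs : {in vs, forall v0, `|dot v0 u| <= 1}.
    by move=> v0 v0vs; apply: uo; rewrite inE v0vs orbT.
  have := row_le _ uvs l; have := uvs _ v_vs; have := uo _ (mem_head _ _).
  (* The newly committed term is split off; it is at most [x l 0] in absolute value, which is what
     the bound [1 - r] gains. *)
  have -> : (A' *m u) l 0 - (r - x) l 0 / a * (dot v' u / 2) =
     (A *m u) l 0 - r l 0 / (a + 1) * (dot v u / 2) +
     x l 0 * ((dot v u - dot v' u) / 2).
    by rewrite A'u !mxE; field; rewrite an a1n.
  have -> : (r - x) l 0 = r l 0 - x l 0 by rewrite !mxE.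
  have /andP[x0 _] := x_box l.
  move: (dot v u) (dot v' u) => s s' s'1 s1 row1.
  apply: le_trans (ler_normD _ _) _.
  have : `|x l 0 * ((s - s') / 2)| <= x l 0.
    rewrite normrM (ger0_norm x0) ler_piMr // normrM normfV (@ger0_norm _ 2) //.
    by have := ler_normB s s'; lra.
  by lra.
- rewrite A'u mulmxDr -scalemxAr Av' scaler0 addr0 Aw !dotDr !dotZr vw.
  rewrite (v'vs v) // v'1 (dotC v') wv' mulr0 add0r addr0 mulr1 mulfVK //.
  by rewrite subrr mul0r scale0r addr0.
- by rewrite dotDr dotZr (dotC v') wv' v'1 mulr1 add0r.
- rewrite !(dotDl, dotDr, dotZl, dotZr) (dotC v') wv' v'1 -natr1 mulrDl mul1r.
  have : a ^+ 2 <= k%:R ^+ 2.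
    by rewrite ler_sqr ?nnegrE ?ler0n ?(ltW ap) // -kj1 ler_nat leq_subr.
  by rewrite expr2; lra.
- move=> l; rewrite !mxE; have /andP[x0 xr] := x_box l; have := rle l; lra.
- have -> : \sum_l (r - x) l 0 = \sum_l r l 0 - dot (const_mx 1) x.
    by rewrite -sumrB; apply: eq_bigr => l _; rewrite !mxE mul1r.
  rewrite xp ?mem_head // dotZr.
  have -> : dot (const_mx 1) r = \sum_l r l 0.
    by apply: eq_bigr => l _; rewrite mxE mul1r.
  rewrite r_sum; field; rewrite a1n pnatr_eq0; lia.
(* A row fractional for [r - x] was fractional before or is so in this rounding, which has
   [j + 2 <= k + 1] constraints. *)
- apply: (@leq_trans (#|fractional (const_mx 1%R) r| + #|fractional r x|)); last first.
    rewrite mulSn addnC leq_add // (leq_trans x_frac) //= size_map size_iota; lia.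
  apply: leq_trans (leq_card_setU _ _); apply: subset_leq_card.
  apply/fintype.subsetP => l; apply: contraLR; rewrite !inE !mxE !negb_or !negb_and !negbK.
  case/andP=> rl /orP[] /eqP ->; last by rewrite subrr eqxx.
  by rewrite subr0.
- move=> l; rewrite !mxE => rx1 u; have /andP[x0 xr] := x_box l.
  have /andP[r0 rl1] := rle l.
  have rl : r l 0 = 1 by lra.
  have xl : x l 0 = 0 by lra.
  have AE := r1 _ rl u; rewrite A'u mxE AE !mxE rl xl; field; by rewrite an a1n.
Qed.

Lemma exists_stage n d (alg : algorithm n d) k j :
  (j < k)%N -> (2 * j + 1 < d)%N -> exists vs v w A r, stage alg k j vs v w A r.
Proof.
elim: j => [|j IHj] jk jd; first by apply: stage0; lia.
have [||vs [v [w [A [r st]]]]] := IHj; [lia|lia|].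
by apply: stageS st => //; lia.
Qed.

Lemma ln_ge_half (x : R) : 2 <= x -> 2^-1 <= ln x.
Proof.
move=> x2; have x0 : 0 < x by lra.
have xV : x^-1 <= 2^-1 by rewrite lef_pV2 ?posrE.
have xV0 : 0 < x^-1 by rewrite invr_gt0.
(* The inequality [ln y <= y - 1] at [y = 1 / x]. *)
have := @le_ln1Dx R (x^-1 - 1); rewrite [1 + _]addrC subrK lnV ?posrE //.
by move=> /(_ ltac:(lra)); lra.
Qed.

(** * The lower bound *)

Theorem theorem2 :
  exists c : R, 0 < c /\
  forall T n d : nat,
    c < T%:R ->
    c * T%:R < d%:R ->
    c * T%:R ^+ 2 * ln (T%:R : R) < n%:R ->
    forall alg : algorithm n d,
    exists A : 'M[R]_(n, d),
      (forall l : 'I_n, rownorm2 A l <= 1) /\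
      (exists w : 'cV[R]_d, vnorm2 w <= 1 /\
         forall p : 'cV[R]_n, in_simplex p ->
           1 / (c * T%:R * Num.sqrt (T%:R * ln (n%:R : R))) <= bilin p A w) /\
      (exists p : 'cV[R]_n, in_simplex p /\ bilin p A (run_output alg A T) <= 0).
Proof.
exists 100; split=> // T n d; rewrite ltr_nat -natrM ltr_nat => cT cd cn alg.
have T100 : 100 < T%:R :> R by rewrite ltr_nat.
have lnT : 2^-1 <= ln (T%:R : R) by apply: ln_ge_half; lra.
have nT : (50 * T ^ 2 < n)%N.
  rewrite -(ltr_nat R) natrM natrX; apply: le_lt_trans cn.
  have := sqr_ge0 (T%:R : R); nra.
have lnn : 2^-1 <= ln (n%:R : R).
  apply: ln_ge_half; rewrite ler_nat; nia.
(* The output is treated as one more query. *)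
pose alg' := Algorithm (fun h : seq (response n d) =>
  if size h == T then (0, alg_output alg h) else alg_query alg h) (alg_output alg).
have hist A m : (m <= T)%N -> history alg' A m = history alg A m.
  elim: m => //= m IHm mT; rewrite IHm ?(ltnW mT) // size_history.
  by rewrite ltn_eqF.
(* With [k = 2 T], half of the total weight [n] is still uncommitted after [T] stages. *)
have [||vs [v [w [A [r [vs_size v_vs vs1 vq span row_le Aw vw ww r_box r_sum r_frac r1]]]]]]
  := @exists_stage n d alg' (2 * T) T; [lia|lia|].
exists A; split; [|split].
- move=> l; set N := rownorm2 A l.
  have N0 : 0 <= N by exact: sqrtr_ge0.
  have [->//|Nn] := eqVneq N 0.
  (* Row [l] attains its norm at its own unit vector, where the row bound of the stage applies. *)
  pose u := N^-1 *: (row l A)^T.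
  have row_mul (x : 'cV[R]_d) : (A *m x) l 0 = dot (row l A)^T x.
    by rewrite mxE; apply: eq_bigr => i _; rewrite !mxE.
  have NN : dot (row l A)^T (row l A)^T = N ^+ 2.
    rewrite sqr_sqrtr; last by apply: sumr_ge0 => i _; exact: sqr_ge0.
    by apply: eq_bigr => i _; rewrite !mxE expr2.
  have u1 : dot u u = 1.
    by rewrite dotZl dotZr NN; field.
  have ubnd : {in vs, forall v', `|dot v' u| <= 1}.
    by move=> v' /vs1 v'1; apply: dot_unit_le1.
  have := row_le _ ubnd l; have := ubnd _ v_vs.
  have -> : (A *m u) l 0 = N by rewrite row_mul dotZr NN; field.
  have := r_box l; rewrite mxE => /andP[r0 rl1].
  have -> : (2 * T - T)%:R = T%:R :> R by congr _%:R; lia.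
  move=> s1 le1.
  have : `|r l 0 / T%:R * (dot v u / 2)| <= r l 0.
    rewrite -mulrA normrM ger0_norm // ler_piMr // !normrM !normfV !normr_nat.
    have T1 : 0 < (T%:R : R)^-1 <= 1 by rewrite invr_gt0 invf_le1; lra.
    by case/andP: T1 => T0 T1; have := normr_ge0 (dot v u); nra.
  rewrite -(ger0_norm N0).
  have := ler_normD (N - r l 0 / T%:R * (dot v u / 2)) (r l 0 / T%:R * (dot v u / 2)).
  rewrite subrK; lra.
(* [D] is the stage's bound on the norm of [w], so [w / D] has margin [1 / (2 D)]. *)
- set D : R := (2 * T)%:R * Num.sqrt T.+1%:R.
  have D0 : 0 < D by rewrite mulr_gt0 ?sqrtr_gt0 ?ltr0n //; lia.
  have DD : D ^+ 2 = T.+1%:R * (2 * T)%:R ^+ 2.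
    by rewrite exprMn sqr_sqrtr ?ler0n // mulrC.
  exists (D^-1 *: w); split.
    have -> : vnorm2 (D^-1 *: w) = Num.sqrt (dot (D^-1 *: w) (D^-1 *: w)).
      by congr Num.sqrt; apply: eq_bigr => i _; rewrite expr2.
    rewrite -[leRHS]sqrtr1 ler_wsqrtr // dotZl dotZr mulrA -invfM -expr2.
    by rewrite mulrC ler_pdivrMr ?exprn_gt0 // mul1r DD.
  move=> p [p0 p1].
  have -> : bilin p A (D^-1 *: w) = D^-1 / 2.
    rewrite /bilin -mulmxA -scalemxAr Aw -scalemxAr mxE trmx_mul_dot mxE mulr1n.
    congr (_ * _); rewrite /dot; under eq_bigr do rewrite mxE.
    by rewrite -mulr_suml p1 mul1r.
  (* The factor 25 is 100 / 4, because [2 D] equals [4 T] times the left-hand side. *)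
  have s1 : Num.sqrt T.+1%:R <= 25 * Num.sqrt (T%:R * ln (n%:R : R)).
    rewrite -[X in X * _](@ger0_norm R 25) // -sqrtr_sqr -sqrtrM ?sqr_ge0 //.
    by apply: ler_wsqrtr; rewrite -natr1; nra.
  have s0 : 0 < Num.sqrt (T.+1%:R : R) by rewrite sqrtr_gt0 ltr0n.
  rewrite mul1r -invfM lef_pV2 ?posrE /D ?natrM; [|nra|nra].
  nra.
(* Otherwise the remaining weight [n / 2] lies on at most [T (2 T + 1)] fractional rows,
   contradicting [n > 50 T^2]. *)
- have [l rl] : exists l, r l 0 = 1.
    apply: contrapT => no1.
    have : \sum_l r l 0 <= #|fractional (const_mx 1) r|%:R.
      rewrite -sum1_card natr_sum [leRHS]big_mkcond /=; apply: ler_sum => l _.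
      have := r_box l; rewrite mxE inE mxE => /andP[r0 rl1].
      case: ifPn => //; rewrite negb_and !negbK => /orP[/eqP -> //|/eqP rl].
      by case: no1; exists l.
    rewrite r_sum; have -> : (2 * T - T)%:R = T%:R :> R by congr _%:R; lia.
    have -> : n%:R * T%:R / (2 * T)%:R = n%:R / 2 :> R.
      by rewrite natrM; field; rewrite gt_eqF //; lra.
    move: r_frac; rewrite -(ler_nat R) natrM -natr1 natrM.
    move: nT; rewrite -(ltr_nat R) natrM natrX; nra.
  exists (delta_mx l 0); split.
    split=> [i|]; first by rewrite mxE ler0n.
    rewrite (bigD1 l) //= mxE !eqxx big1 ?addr0 // => i il.
    by rewrite mxE (negPf il).
  rewrite /bilin -mulmxA trmx_mul_dot mxE mulr1n dot_delta r1 //.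
  (* Query number [T] of [alg'], counted from 0, is the output of [alg]. *)
  have := vq T (leqnn T); rewrite hist //= size_history eqxx /= -/(run_output alg A T) => ->.
  by rewrite !mul0r.
Qed.
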